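(* Regular variation in $L^2[0,1]$ of a sample-continuous process does not in general imply its regular variation in $\mathcal{C}[0,1]$: there exists a sample-continuous stochastic process over $[0,1]$ which is regularly varying in $L^2[0,1]$ but not in $\mathcal{C}[0,1]$.
   Context: A continuous process on $[0,1]$ is regarded as a random element of $\mathcal{C}[0,1]$ (with the sup-norm) and also of $L^2[0,1]$ (with the $L^2$-norm). Regular variation. Let $E$ be a separable real Banach space (here $E=\mathcal{C}[0,1]$ with the sup-norm, or $E=L^2[0,1]$) and $E_0=E\setminus\{0\}$. Let $\mathcal{C}_0$ be the set of bounded continuous functions $f:E_0\to\mathbb{R}$ vanishing in some neighborhood of $0$, and $M_0(E)$ the class of Borel measures on $E_0$ that are finite on every Borel subset of $E_0$ bounded away from $0$. A sequence $\mu_n$ converges to $\mu$ in $M_0(E)$ if $\int f\,d\mu_n\to\int f\,d\mu$ for all $f\in\mathcal{C}_0$. A measurable function $b$ is regularly varying with index $\rho$ if $b(tx)/b(t)\to x^\rho$ as $t\to\infty$ for every $x>0$. A random element $X$ of $E$ is regularly varying with index $\alpha>0$ (written $X\in RV_{-\alpha}(E)$) if there exist a nonzero $\mu\in M_0(E)$ and a regularly varying function $b$ such that $b(n)\,\mathbb{P}(X\in n\,\cdot)\to\mu(\cdot)$ in $M_0(E)$ as $n\to\infty$, where the limit satisfies $\mu(tA)=t^{-\alpha}\mu(A)$ for all $t>0$ and Borel $A\subset E_0$. $X$ is regularly varying in $E$ if this holds for some $\alpha>0$. *)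

(* Defs.v *)
From HB Require Import structures.
From mathcomp Require Import all_boot all_order all_algebra.
From mathcomp Require Import all_classical all_reals all_analysis.
From mathcomp Require Import measurable_realfun ess_sup_inf.
From mathcomp Require Import lra.
Set Implicit Arguments. Unset Strict Implicit. Unset Printing Implicit Defensive.
Import Order.TTheory GRing.Theory Num.Theory.
Import numFieldNormedType.Exports.
Local Open Scope classical_set_scope.
Local Open Scope ring_scope.

Section Lspace_normed.
Context d (T : measurableType d) (R : realType).
Context (mu : {measure set T -> \bar R}) (p : \bar R) (p1 : (1 <= p)%E).
Local Notation Lf := (LfunType mu p1).
Local Notation Ls := (LspaceType mu p1).

HB.instance Definition _ := gen_eqMixin Ls.
HB.instance Definition _ := gen_choiceMixin Ls.

Local Open Scope quotient_scope.

Lemma Lnorm_ae_eq (f g : T -> R) :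
  measurable_fun setT f -> measurable_fun setT g ->
  f = g %[ae mu] -> ('N[mu]_p[EFin \o f] = 'N[mu]_p[EFin \o g])%E.
Proof.
have mpow (h : T -> R) r : measurable_fun setT h ->
    measurable_fun setT (fun x => `|h x| `^ r).
  move=> mh.
  apply: (@measurableT_comp _ _ _ _ _ _ (@powR R ^~ r)) => //.
  exact: measurableT_comp.
move=> mf mg fg; rewrite unlock /Lnorm.
case: p p1 => [r r1| |//].
- congr (_ `^ _)%E; apply: ae_eq_integral => //.
  + by apply/measurable_EFinP; exact: mpow.
  + by apply/measurable_EFinP; exact: mpow.
  + by apply: filterS fg => x /= + _ => /(_ I) ->.
- move=> _; case: ifPn => // _; apply: eq_ess_sup.
  by apply: filterS fg => x /= /(_ I) ->.
Qed.

Lemma Lspace_Lfun (f : Ls) : (f : T -> R) \in Lfun mu p.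
Proof.
apply/andP; split; rewrite inE /=; last exact: Lebesgue_finite.
exact: (@measurable_funPT _ _ T (measurableTypeR R) (repr (f : aeEqMfun _ _))).
Qed.

Definition Lspace_repr (f : Ls) : Lf := Lfun_Sub p1 (Lspace_Lfun f).

Lemma Lfun_measurable (f : Lf) : measurable_fun setT (f : T -> R).
Proof. exact: (@measurable_funPT _ _ T R f). Qed.

(* [R] and [measurableTypeR R] carry the same sigma-algebra under different
   displays, and [LspaceType] uses the latter. *)
Definition Lfun_mfun (f : Lf) : T -> measurableTypeR R := f.
HB.instance Definition _ (f : Lf) :=
  isMeasurableFun.Build _ _ T (measurableTypeR R) (Lfun_mfun f)
    (Lfun_measurable f).

Definition Lclass_mfun (f : Lf) : {mfun_ mu, T >-> measurableTypeR R} :=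
  \pi_({mfun_ mu, T >-> measurableTypeR R}) (Lfun_mfun f).

Lemma Lclass_mfunE (f : Lf) : (Lclass_mfun f : T -> R) = f %[ae mu].
Proof.
have : repr (Lclass_mfun f) == Lfun_mfun f
    %[mod {mfun_ mu, T >-> measurableTypeR R}] by rewrite reprK.
by rewrite eqmodE => /asboolP.
Qed.

Lemma Lclass_mfun_finite (f : Lf) :
  finite_norm mu p (Lclass_mfun f : T -> R).
Proof.
rewrite /finite_norm (@Lnorm_ae_eq _ f).
- exact: (@Lfunction_finite _ _ _ _ _ p1 f).
- exact: (@measurable_funPT _ _ T (measurableTypeR R) (repr (Lclass_mfun f))).
- exact: Lfun_measurable.
- exact: Lclass_mfunE.
Qed.

HB.instance Definition _ (f : Lf) :=
  isFinLebesgue.Build _ T R mu p p1 (Lclass_mfun f) (Lclass_mfun_finite f).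

Definition Lclass (f : Lf) : Ls := Lclass_mfun f.

Lemma LclassE (f : Lf) : (Lclass f : T -> R) = f %[ae mu].
Proof. exact: Lclass_mfunE. Qed.

Lemma Lspace_eqP (f g : Ls) : f = g <-> (f : T -> R) = g %[ae mu].
Proof.
split=> [->|fg]; first exact: ae_eq_refl.
have : LebesgueSpace.sort f = LebesgueSpace.sort g.
  by apply/eqP; rewrite -[X in X == _]reprK -[X in _ == X]reprK eqmodE; apply/asboolP.
case: f g fg => [f [[fi]]] [g [[gi]]] /= _ E; subst g.
by rewrite (Prop_irrelevance fi gi).
Qed.

Lemma LclassP (f g : Lf) : Lclass f = Lclass g <-> (f : T -> R) = g %[ae mu].
Proof.
rewrite Lspace_eqP; split => h.
  apply: ae_eq_trans (LclassE g); apply: ae_eq_trans h; exact/ae_eq_sym/LclassE.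
apply: ae_eq_trans (LclassE f) _; apply: ae_eq_trans h _; exact/ae_eq_sym/LclassE.
Qed.

Lemma Lspace_reprE (f : Ls) : (Lspace_repr f : T -> R) = f.
Proof. by []. Qed.

Lemma Lspace_reprK : cancel Lspace_repr Lclass.
Proof. by move=> f; apply/Lspace_eqP/LclassE. Qed.

Definition Lspace_zero : Ls := Lclass 0.
Definition Lspace_opp (f : Ls) : Ls := Lclass (- Lspace_repr f).
Definition Lspace_add (f g : Ls) : Ls := Lclass (Lspace_repr f + Lspace_repr g).
Definition Lspace_scale (a : R) (f : Ls) : Ls := Lclass (a *: Lspace_repr f).

Lemma Lspace_oppE f : Lspace_opp (Lclass f) = Lclass (- f).
Proof.
apply/LclassP; apply: filterS (LclassE f) => x + _ => /(_ I) fE.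
exact: (congr1 -%R fE).
Qed.

Lemma Lspace_addE f g : Lspace_add (Lclass f) (Lclass g) = Lclass (f + g).
Proof.
apply/LclassP; apply: filterS2 (LclassE f) (LclassE g) => x fx gx _.
exact: (congr2 +%R (fx I) (gx I)).
Qed.

Lemma Lspace_scaleE a f : Lspace_scale a (Lclass f) = Lclass (a *: f).
Proof.
apply/LclassP; apply: filterS (LclassE f) => x + _ => /(_ I) fE.
exact: (congr1 ( *%R a) fE).
Qed.

Lemma Lspace_addA : associative Lspace_add.
Proof.
move=> f g h; rewrite -[f]Lspace_reprK -[g]Lspace_reprK -[h]Lspace_reprK.
by rewrite !Lspace_addE addrA.
Qed.

Lemma Lspace_addC : commutative Lspace_add.
Proof. by move=> f g; rewrite /Lspace_add addrC. Qed.

Lemma Lspace_add0 : left_id Lspace_zero Lspace_add.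
Proof. by move=> f; rewrite -[f]Lspace_reprK Lspace_addE add0r. Qed.

Lemma Lspace_addN : left_inverse Lspace_zero Lspace_opp Lspace_add.
Proof.
by move=> f; rewrite -[f]Lspace_reprK Lspace_oppE Lspace_addE addNr.
Qed.

HB.instance Definition _ := GRing.isZmodule.Build Ls
  Lspace_addA Lspace_addC Lspace_add0 Lspace_addN.

Lemma LclassD f g : Lclass (f + g) = Lclass f + Lclass g.
Proof. by rewrite -Lspace_addE. Qed.

Lemma Lspace_scaleA a b f :
  Lspace_scale a (Lspace_scale b f) = Lspace_scale (a * b) f.
Proof. by rewrite -[f]Lspace_reprK !Lspace_scaleE scalerA. Qed.

Lemma Lspace_scale1 : left_id 1 Lspace_scale.
Proof. by move=> f; rewrite -[f]Lspace_reprK Lspace_scaleE scale1r. Qed.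

Lemma Lspace_scaleDr : right_distributive Lspace_scale +%R.
Proof.
move=> a f g; rewrite -[f]Lspace_reprK -[g]Lspace_reprK -LclassD.
by rewrite !Lspace_scaleE scalerDr LclassD.
Qed.

Lemma Lspace_scaleDl f : {morph Lspace_scale^~ f : a b / a + b}.
Proof.
move=> a b; rewrite -[f]Lspace_reprK.
by rewrite !Lspace_scaleE scalerDl LclassD.
Qed.

HB.instance Definition _ := GRing.Zmodule_isLmodule.Build R Ls
  Lspace_scaleA Lspace_scale1 Lspace_scaleDr Lspace_scaleDl.

Lemma LclassZ a f : Lclass (a *: f) = a *: Lclass f.
Proof. by rewrite -Lspace_scaleE. Qed.

Definition Lspace_norm (f : Ls) : R := fine 'N[mu]_p[EFin \o (f : T -> R)].

Lemma Lspace_normE (f : Lf) : Lspace_norm (Lclass f) = fine 'N[mu]_p[EFin \o f].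
Proof.
congr fine; apply: Lnorm_ae_eq; last exact: LclassE.
- exact: (Lfun_measurable (Lspace_repr (Lclass f))).
- exact: Lfun_measurable.
Qed.

Lemma Lspace_normD (f g : Ls) :
  Lspace_norm (f + g) <= Lspace_norm f + Lspace_norm g.
Proof.
rewrite -[f]Lspace_reprK -[g]Lspace_reprK -LclassD !Lspace_normE.
exact: ler_LnormD.
Qed.

Lemma Lspace_normZ a (f : Ls) : Lspace_norm (a *: f) = `|a| * Lspace_norm f.
Proof.
rewrite -[f]Lspace_reprK -LclassZ !Lspace_normE.
by rewrite (LnormZ (Lspace_repr f) a) fineM// -finite_norm_fine.
Qed.

Lemma Lspace_norm0_eq0 (f : Ls) : Lspace_norm f = 0 -> f = 0.
Proof.
rewrite -[f]Lspace_reprK Lspace_normE => /fine_Lnormr_eq0 f0.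
exact/LclassP.
Qed.

HB.instance Definition _ := Lmodule_isNormed.Build R Ls
  Lspace_normD Lspace_normZ Lspace_norm0_eq0.

End Lspace_normed.

Definition I01 (R : realType) : set R := `[0, 1]%classic.
Arguments I01 : clear implicits.

Definition C01 (R : realType) : Type := continuousType (I01 R) R.

Section C01_normed.
Context (R : realType).
Local Notation C01 := (C01 R).
Implicit Types (f g : C01) (t : I01 R).

HB.instance Definition _ := Choice.on C01.

Definition C01_mk (h : I01 R -> R) (ch : continuous h) : C01 :=
  [the continuousType (I01 R) R of mkcts ch].

Lemma C01_cts f : continuous f. Proof. exact: (@cts_fun _ _ f). Qed.

Lemma C01P f g : f = g <-> forall t, f t = g t.
Proof. exact: continuousEP. Qed.

Lemma clamp01_subproof (x : R) : Num.max 0 (Num.min 1 x) \in I01 R.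
Proof.
rewrite inE /I01 /= in_itv /= le_max lexx /= ge_max ler01 /=.
by rewrite ge_min lexx.
Qed.

Definition clamp01 (x : R) : I01 R :=
  exist (fun y => y \in I01 R) _ (clamp01_subproof x).

Lemma clamp01_val t : clamp01 (val t) = t.
Proof.
apply: val_inj => /=; case: t => x /=; rewrite inE /I01 /= in_itv /= => /andP[x0 x1].
by rewrite min_r// max_r.
Qed.

Lemma clamp01_continuous : continuous clamp01.
Proof.
apply: continuous_comp_initial => x /=.
apply: (@continuous_max R R (cst 0) (fun x => Num.min 1 x)).
  exact: cvg_cst.
apply: (@continuous_min R R (cst 1) id); first exact: cvg_cst.
exact: cvg_id.
Qed.

(* The constant extension outside [0, 1]. *)
Definition C01_ext f : R -> R := f \o clamp01.

Lemma C01_ext_continuous f : continuous (C01_ext f).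
Proof.
move=> x; apply: continuous_comp; first exact: clamp01_continuous.
exact: C01_cts.
Qed.

Lemma C01_norm_bounded f : has_ubound [set `|f t| | t in setT].
Proof.
have cF : {within `[0:R, 1], continuous (fun x => `|C01_ext f x|)}.
  apply: continuous_subspaceT => x.
  by apply: cvg_norm; exact: C01_ext_continuous.
have [c _ cmax] := EVT_max ler01 cF.
exists (`|C01_ext f c|) => _ [t _ <-].
rewrite -[t]clamp01_val; apply: cmax.
by have := valP t; rewrite inE.
Qed.

Definition C01_norm f : R := sup [set `|f t| | t in setT].

Lemma C01_norm_ub f t : `|f t| <= C01_norm f.
Proof. by apply: ub_le_sup; [exact: C01_norm_bounded|exists t]. Qed.

Lemma C01_norm_le f M : (forall t, `|f t| <= M) -> C01_norm f <= M.
Proof.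
move=> fM; apply: ge_sup; first by exists `|f (clamp01 0)|; exists (clamp01 0).
by move=> _ [t _ <-].
Qed.

Lemma C01_cst_continuous (c : R) : continuous (fun _ : I01 R => c).
Proof. exact: cst_continuous. Qed.

Lemma C01_opp_continuous f : continuous (fun t => - f t).
Proof.
have H (T : topologicalType) (h : T -> R) : continuous h ->
  continuous (fun x => - h x) by move=> ch x; apply: cvgN; exact: ch.
by apply: H; exact: C01_cts.
Qed.

Lemma C01_add_continuous f g : continuous (fun t => f t + g t).
Proof.
have H (T : topologicalType) (h k : T -> R) : continuous h -> continuous k ->
  continuous (fun x => h x + k x).
  by move=> ch ck x; apply: cvgD; [exact: ch|exact: ck].
by apply: H; exact: C01_cts.
Qed.

Lemma C01_scale_continuous (a : R) f : continuous (fun t => a * f t).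
Proof.
have H (T : topologicalType) (h : T -> R) : continuous h ->
  continuous (fun x => a * h x).
  by move=> ch x; apply: cvgM; [exact: cvg_cst|exact: ch].
by apply: H; exact: C01_cts.
Qed.

Definition C01_zero : C01 := C01_mk (@C01_cst_continuous 0).
Definition C01_opp f : C01 := C01_mk (@C01_opp_continuous f).
Definition C01_add f g : C01 := C01_mk (@C01_add_continuous f g).
Definition C01_scale (a : R) f : C01 := C01_mk (@C01_scale_continuous a f).

Lemma C01_addA : associative C01_add.
Proof. by move=> f g h; apply/C01P => t; exact: addrA. Qed.
Lemma C01_addC : commutative C01_add.
Proof. by move=> f g; apply/C01P => t; exact: addrC. Qed.
Lemma C01_add0 : left_id C01_zero C01_add.
Proof. by move=> f; apply/C01P => t; exact: add0r. Qed.
Lemma C01_addN : left_inverse C01_zero C01_opp C01_add.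
Proof. by move=> f; apply/C01P => t; exact: addNr. Qed.

HB.instance Definition _ := GRing.isZmodule.Build C01
  C01_addA C01_addC C01_add0 C01_addN.

Lemma C01_scaleA a b f : C01_scale a (C01_scale b f) = C01_scale (a * b) f.
Proof. by apply/C01P => t; exact: mulrA. Qed.
Lemma C01_scale1 : left_id 1 C01_scale.
Proof. by move=> f; apply/C01P => t; exact: mul1r. Qed.
Lemma C01_scaleDr : right_distributive C01_scale +%R.
Proof. by move=> a f g; apply/C01P => t; exact: mulrDr. Qed.
Lemma C01_scaleDl f : {morph C01_scale^~ f : a b / a + b}.
Proof. by move=> a b; apply/C01P => t; exact: mulrDl. Qed.

HB.instance Definition _ := GRing.Zmodule_isLmodule.Build R C01
  C01_scaleA C01_scale1 C01_scaleDr C01_scaleDl.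

Lemma C01D f g t : (f + g) t = f t + g t. Proof. by []. Qed.
Lemma C01N f t : (- f) t = - f t. Proof. by []. Qed.
Lemma C01Z a f t : (a *: f) t = a * f t. Proof. by []. Qed.

Lemma C01_normD f g : C01_norm (f + g) <= C01_norm f + C01_norm g.
Proof.
apply: C01_norm_le => t; rewrite C01D (le_trans (ler_normD _ _))//.
by rewrite lerD// C01_norm_ub.
Qed.

Lemma C01_normZ a f : C01_norm (a *: f) = `|a| * C01_norm f.
Proof.
have le b g : C01_norm (b *: g) <= `|b| * C01_norm g.
  by apply: C01_norm_le => t; rewrite C01Z normrM ler_wpM2l// C01_norm_ub.
apply/eqP; rewrite eq_le le /=; have [->|a0] := eqVneq a 0.
  rewrite normr0 mul0r (le_trans _ (C01_norm_ub _ (clamp01 0)))//.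
rewrite -ler_pdivlMl ?normr_gt0// -normfV (le_trans _ (le _ _))//.
by rewrite scalerA mulVf// scale1r.
Qed.

Lemma C01_norm0_eq0 f : C01_norm f = 0 -> f = 0.
Proof.
move=> f0; apply/C01P => t; apply/eqP; rewrite -normr_le0 -f0.
exact: C01_norm_ub.
Qed.

HB.instance Definition _ := Lmodule_isNormed.Build R C01
  C01_normD C01_normZ C01_norm0_eq0.

Lemma C01_normE f : `|f| = sup [set `|f t| | t in setT].
Proof. by []. Qed.

End C01_normed.

Section Borel.
Context {R : realType}.

Definition borel (E : normedModType R) : Type := g_sigma_algebraType (@open E).
HB.instance Definition _ (E : normedModType R) := Measurable.on (borel E).

Lemma open_borel (E : normedModType R) (U : set E) :
  open U -> measurable (U : set (borel E)).
Proof. by move=> oU; apply: sub_sigma_algebra. Qed.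

Lemma closed_borel (E : normedModType R) (U : set E) :
  closed U -> measurable (U : set (borel E)).
Proof.
by move=> cU; rewrite -[U]setCK; apply: measurableC; apply: open_borel; exact: closed_openC.
Qed.

Lemma measurable_borel d (T : measurableType d) (E : normedModType R) (X : T -> borel E) :
  (forall U : set E, open U -> measurable (X @^-1` U)) -> measurable_fun setT X.
Proof.
move=> mX; apply: (@measurability _ _ T (borel E) setT X (@open E)) => //.
by move=> _ [U oU <-]; rewrite setTI; exact: mX.
Qed.

Lemma continuous_borel (E F : normedModType R) (h : E -> F) :
  continuous h -> measurable_fun setT (h : borel E -> borel F).
Proof.
move=> /continuousP ch; apply: measurable_borel => U oU.
by apply: open_borel; exact: ch.
Qed.

Definition punctured (E : normedModType R) : set E := [set x | x != 0].
Arguments punctured : clear implicits.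

Lemma punctured_borel (E : normedModType R) : measurable (punctured E : set (borel E)).
Proof.
have -> : punctured E = ~` [set (0 : E)].
  by apply/seteqP; split=> x /= /eqP.
apply: open_borel; apply: closed_openC.
by apply: accessible_closed_set1; apply: hausdorff_accessible; exact: norm_hausdorff.
Qed.

Definition bounded_away0 (E : normedModType R) (A : set E) :=
  exists2 e : R, 0 < e & forall x, A x -> e <= `|x|.

(* A Borel measure on E \ {0} is encoded as a Borel measure on E without mass
   at 0: since {0} is closed, the Borel sets of E \ {0} are the Borel sets of E
   that do not contain 0. *)
Record M0 (E : normedModType R) := MkM0 {
  M0_measure :> {measure set (borel E) -> \bar R};
  M0_at0 : M0_measure [set (0 : E)] = 0%E;
  M0_finite : forall A : set (borel E), measurable A -> bounded_away0 A ->
    (M0_measure A < +oo)%E }.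

(* Test functions on E \ {0}; the value at 0 is never used. *)
Definition C0 (E : normedModType R) : set (E -> R) :=
  [set f | [/\ {within punctured E, continuous f},
               exists M, forall x, punctured E x -> `|f x| <= M
             & \forall x \near (0 : E)^', f x = 0] ].

Arguments C0 : clear implicits.

Definition cvg_M0 (E : normedModType R) (mu_ : nat -> M0 E) (mu : M0 E) :=
  forall f : borel E -> R, C0 E f ->
    (\int[mu_ n]_(x in punctured E) (f x)%:E @[n --> \oo] -->
     \int[mu]_(x in punctured E) (f x)%:E)%E.

Definition regularly_varying_fun (rho : R) (b : R -> R) :=
  measurable_fun setT b /\
  forall x, 0 < x -> b (t * x) / b t @[t --> +oo] --> x `^ rho.

Section scaled_law.
Context d (T : measurableType d) (P : probability T R) (E : normedModType R).

Definition scaled_rv (X : {RV P >-> borel E}) (c : R) : T -> borel E :=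
  fun w => c *: (X w : E).

Lemma scaled_rv_measurable X c : measurable_fun setT (scaled_rv X c).
Proof.
apply: (@measurableT_comp _ _ _ _ _ _ (( *:%R c : E -> E) : borel E -> borel E)) => //.
by apply: continuous_borel; exact: scaler_continuous.
Qed.

HB.instance Definition _ X c :=
  isMeasurableFun.Build _ _ T (borel E) (scaled_rv X c) (@scaled_rv_measurable X c).

(* b times the law of X / n on E \ {0}; see [scaled_lawE]. *)
Definition scaled_law_measure (X : {RV P >-> borel E}) (b : {nonneg R}) (n : nat) :
    {measure set (borel E) -> \bar R} :=
  mscale b (mrestr (distribution P (scaled_rv X n%:R^-1)) (@punctured_borel E)).

Lemma scaled_law_measureE X b n (A : set (borel E)) :
  scaled_law_measure X b n A =
  (b%:num%:E * P (scaled_rv X n%:R^-1 @^-1` (A `&` punctured E)))%E.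
Proof. by []. Qed.

Lemma scaled_law_at0 X b n : scaled_law_measure X b n [set 0] = 0%E.
Proof.
rewrite scaled_law_measureE.
rewrite (_ : _ `&` _ = set0) ?preimage_set0 ?measure0 ?mule0//.
by apply/seteqP; split=> // x [/= ->]; rewrite /punctured /= eqxx.
Qed.

Lemma scaled_law_finite X b n (A : set (borel E)) : measurable A ->
  bounded_away0 A -> (scaled_law_measure X b n A < +oo)%E.
Proof.
move=> mA _; rewrite scaled_law_measureE.
rewrite lte_mul_pinfty// (le_lt_trans (probability_le1 _ _)) ?ltry//.
rewrite -[X in measurable X]setTI; apply: measurable_funP => //.
by apply: measurableI => //; exact: punctured_borel.
Qed.

Definition scaled_law X b n : M0 E :=
  MkM0 (scaled_law_at0 X b n) (@scaled_law_finite X b n).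

Lemma scaled_lawE X b n (A : set (borel E)) : (0 < n)%N -> A `<=` punctured E ->
  scaled_law X b n A =
  (b%:num%:E * P (X @^-1` [set n%:R *: (x : E) | x in A]))%E.
Proof.
move=> n0 A0; rewrite [LHS]scaled_law_measureE (setIidl A0); congr (_ * P _)%E.
have nn0 : n%:R != 0 :> R by rewrite pnatr_eq0 -lt0n.
apply/seteqP; split=> w /=; rewrite /scaled_rv.
  by move=> Aw; exists (n%:R^-1 *: (X w : E)) => //; rewrite scalerA divff// scale1r.
by move=> [x Ax <-]; rewrite scalerA mulVf// scale1r.
Qed.

(* b takes nonnegative values so that b(n) P(X \in n .) is a measure. *)
Definition regularly_varying_index (alpha : R) (X : {RV P >-> borel E}) :=
  exists (mu : M0 E) (rho : R) (b : R -> {nonneg R}),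
  [/\ (mu setT != 0)%E,
      regularly_varying_fun rho (fun t => (b t)%:num),
      cvg_M0 (fun n => scaled_law X (b n%:R) n) mu
    & forall (t : R) (A : set (borel E)), 0 < t -> measurable A ->
        A `<=` punctured E ->
        mu [set t *: (x : E) | x in A] = ((t `^ (- alpha))%:E * mu A)%E ].

Definition regularly_varying (X : {RV P >-> borel E}) :=
  exists2 alpha : R, 0 < alpha & regularly_varying_index alpha X.

End scaled_law.
End Borel.
Arguments punctured {R} E.
Arguments C0 {R} E.

Definition sample_continuous {R : realType} d (T : measurableType d)
    (P : probability T R) (X : I01 R -> {RV P >-> R}) :=
  forall w, continuous (fun t => X t w).

Section paths.
Context {R : realType} d (T : measurableType d) (P : probability T R).
Context (X : I01 R -> {RV P >-> R}) (cX : sample_continuous X).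

Definition path01 (w : T) : borel (C01 R) := C01_mk (@cX w).

(* Each (p, r, v) in s forces g to be close to v on ]p - r, p + r[; such
   sets, for s covering [0, 1], form a countable base of C[0, 1]. *)
Let tube (s : seq (rat * rat * rat)) (k : nat) : set (C01 R) :=
  [set g | forall x : rat * rat * rat, x \in s -> forall q : rat,
    `|ratr q - ratr x.1.1 : R| < ratr x.1.2 ->
    `|C01_ext g (ratr q) - ratr x.2| <= k.+1%:R^-1].

Let covers (s : seq (rat * rat * rat)) := forall t : R, t \in `[0, 1] ->
  exists2 x : rat * rat * rat, x \in s & `|t - ratr x.1.1| < ratr x.1.2.

Let tube_path_measurable s k : measurable (path01 @^-1` tube s k).
Proof.
rewrite (_ : _ @^-1` _ = \bigcap_(x : rat * rat * rat * rat)
  (if (x.1 \in s) && (`|ratr x.2 - ratr x.1.1.1 : R| < ratr x.1.1.2)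
   then X (clamp01 (ratr x.2)) @^-1` [set y | `|y - ratr x.1.2| <= k.+1%:R^-1]
   else setT)); last first.
  apply/seteqP; split=> w.
    move=> tw [x q] _ /=; case: ifPn => // /andP[xs qx].
    exact: (tw x xs q qx).
  move=> tw x xs q qx; have /= := tw (x, q) I.
  by rewrite xs qx.
rewrite -[X in measurable X]setCK setC_bigcap; apply: measurableC.
apply: countable_bigcupT_measurable => [|x]; first exact: countableP.
apply: measurableC; case: ifPn => // _.
rewrite -[X in measurable X]setTI; apply: measurable_funP => //.
rewrite (_ : [set y | _] = `[ratr x.1.2 - k.+1%:R^-1, ratr x.1.2 + k.+1%:R^-1]%classic).
  exact: measurable_itv.
by apply/seteqP; split=> y /=; rewrite in_itv /= ler_distl.
Qed.

Let tube_near g h s k : covers s -> tube s k g -> tube s k h ->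
  `|g - h| <= 2 * k.+1%:R^-1.
Proof.
move=> cs tg th; apply: C01_norm_le => t.
rewrite C01D C01N -[t]clamp01_val leNgt; apply/negP => ght.
have [|x xs xt] := cs (val t); first by have := valP t; rewrite inE.
have /= oI : nbhs (val t : R) [set y : R | `|y - ratr x.1.1| < ratr x.1.2 /\
    2 * k.+1%:R^-1 < `|C01_ext g y - C01_ext h y|].
  apply: filterI.
    apply: (@open_nbhs_nbhs _ _ [set y : R | `|y - ratr x.1.1| < ratr x.1.2]); split => //.
    rewrite (_ : mkset _ = ball (ratr x.1.1 : R) (ratr x.1.2)); first exact: ball_open.
    by apply/seteqP; split => y; rewrite -ball_normE /ball_ /= distrC.
  have ce : `|C01_ext g y - C01_ext h y| @[y --> val t] -->
      `|C01_ext g (val t) - C01_ext h (val t)|.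
    by apply: cvg_norm; apply: cvgB; exact: C01_ext_continuous.
  by apply: (cvgr_gt _ ce).
have [y [/= + [q _ qy]]] :=
  dense_rat (ex_intro _ _ (nbhs_singleton (nbhs_interior oI))) (open_interior _).
move=> /interior_subset [+ +]; rewrite -{}qy => qx; rewrite ltNge => /negP; apply.
have -> : C01_ext g (ratr q) - C01_ext h (ratr q) =
  (C01_ext g (ratr q) - ratr x.2) - (C01_ext h (ratr q) - ratr x.2).
  by rewrite opprB addrA subrK.
rewrite (le_trans (ler_normB _ _))// mulr_natl mulr2n lerD//.
  exact: tg xs _ qx.
exact: th xs _ qx.
Qed.

Let tube_ex g k : exists2 s, covers s & tube s k g.
Proof.
have aux (a b c e : R) : a < c -> c < a + e / 2 -> `|a - b| < e / 2 ->
    `|b - c| <= e.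
  by move=> ? ?; rewrite ltr_norml ler_norml => /andP[? ?]; apply/andP; split; lra.
have := @segment_compact R 0 1; rewrite compact_cover.
move=> /(_ _ [set x | tube [:: x] k g]
  (fun x : rat * rat * rat => [set y : R | `|y - ratr x.1.1| < ratr x.1.2])).
case.
- move=> x _; rewrite (_ : mkset _ = ball (ratr x.1.1 : R) (ratr x.1.2)); first exact: ball_open.
  by apply/seteqP; split => y; rewrite -ball_normE /ball_ /= distrC.
- move=> t _.
  have e0 : 0 < k.+1%:R^-1 / 2 :> R by rewrite divr_gt0.
  have /cvgrPdist_lt/(_ _ e0)/nbhs_ballP[r /= r0 rg] := C01_ext_continuous (f:=g) (x:=t).
  have [v] := @rat_in_itvoo R (C01_ext g t) (C01_ext g t + k.+1%:R^-1 / 2)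
    (ltr_pwDr e0 (lexx _)).
  rewrite in_itv /= => /andP[v1 v2].
  have r4 : t < t + r / 4 by rewrite ltrDl divr_gt0.
  have [p] := rat_in_itvoo r4; rewrite in_itv /= => /andP[p1 p2].
  have r42 : r / 4 < r / 2 by lra.
  have [q] := rat_in_itvoo r42; rewrite in_itv /= => /andP[q1 q2].
  exists (p, q, v) => /=; last by rewrite ltr_norml; apply/andP; split; lra.
  move=> x; rewrite inE => /eqP -> /= z zq.
  have := rg (ratr z); rewrite -ball_normE /ball_ /= => /(_ _)/wrap[].
    move: zq; rewrite !ltr_norml => /andP[z1 z2]; apply/andP; split; lra.
  exact: aux v1 v2.
- move=> D DD cD; exists (finmap.enum_fset D).
  + by move=> t /cD[x xD tx]; exists x.
  + move=> x xD q; have := DD x xD; rewrite inE /= => /(_ x); apply.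
    by rewrite inE.
Qed.

Lemma path01_measurable : measurable_fun setT path01.
Proof.
apply: measurable_borel => U oU.
rewrite (_ : _ @^-1` _ = \bigcup_(x : seq (rat * rat * rat) * nat)
  (if `[< covers x.1 /\ tube x.1 x.2 `<=` U >] then path01 @^-1` tube x.1 x.2 else set0)).
  apply: countable_bigcupT_measurable => [|x]; first exact: countableP.
  by case: ifPn => _; [exact: tube_path_measurable|exact: measurable0].
apply/seteqP; split=> w /=; last first.
  by move=> [x _]; case: ifPn => // /asboolP[_]; exact.
move=> Uw; have : nbhs (path01 w : C01 R) U by apply: open_nbhs_nbhs.
rewrite -nbhs_ballE => -[e /= e0 eU].
have e20 : 0 < e / 2 by rewrite divr_gt0.
have [k _ /(_ k (leqnn k)) /= ke] := near_infty_natSinv_lt (PosNum e20).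
have [s cs ts] := tube_ex (path01 w) k.
exists (s, k) => //=; rewrite asboolT//; split=> // g tg; apply: eU.
rewrite -ball_normE /ball_ /= (le_lt_trans (tube_near cs ts tg))//.
by rewrite mulrC -ltr_pdivlMr.
Qed.

End paths.

Section L2_01.
Context (R : realType).

(* L^2[0, 1] is the space of classes of functions on R modulo equality almost
   everywhere for the Lebesgue measure restricted to [0, 1]; the values outside
   [0, 1] are thus immaterial. *)
Definition lebesgue01 : {measure set (measurableTypeR R) -> \bar R} :=
  mrestr (@lebesgue_measure R) (measurable_itv `[0, 1]).

Lemma lebesgue01_setT : lebesgue01 setT = 1%E.
Proof.
rewrite /lebesgue01 /= /mrestr setTI (lebesgue_measure_itv `[0, 1]) /=.
by rewrite lte_fin ltr01 sube0.
Qed.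

Definition L2_01 : Type := LspaceType2 lebesgue01.


Lemma C01_ext_measurable (f : C01 R) :
  measurable_fun setT (C01_ext f : measurableTypeR R -> R).
Proof. exact: (continuous_measurable_fun (@C01_ext_continuous R f)). Qed.

Lemma C01_ext_Lnorm (f : C01 R) :
  ('N[lebesgue01]_2[EFin \o C01_ext f] <= `|f|%:E)%E.
Proof.
have i2 : (\int[lebesgue01]_x (`|(C01_ext f x)%:E| `^ 2) <= (`|f| `^ 2)%:E)%E.
  have -> : ((`|f| `^ 2)%:E = \int[lebesgue01]_x (cst (`|f| `^ 2)%:E x))%E.
    by rewrite integral_cst// lebesgue01_setT mule1.
  apply: ge0_le_integral => //.
  - by move=> x _; exact: poweR_ge0.
  - apply/measurable_EFinP.
    apply: (@measurableT_comp _ _ _ _ _ _ (@powR R ^~ 2)) => //.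
    apply: measurableT_comp => //; exact: C01_ext_measurable.
  - move=> x _; rewrite poweR_EFin lee_fin.
    by rewrite ge0_ler_powR ?nnegrE//; exact: C01_norm_ub.
rewrite unlock /Lnorm.
have -> : (`|f|%:E = (`|f| `^ 2)%:E `^ 2^-1)%E.
  by rewrite poweR_EFin -powRrM divff// powRr1.
apply: gt0_ler_poweR => //; rewrite in_itv /= leey andbT.
- by rewrite integral_ge0// => x _; exact: poweR_ge0.
- by rewrite lee_fin powR_ge0.
Qed.

Lemma C01_ext_Lfun (f : C01 R) :
  (C01_ext f : measurableTypeR R -> R) \in Lfun lebesgue01 2.
Proof.
apply/andP; split; rewrite inE /=; first exact: C01_ext_measurable.
exact: le_lt_trans (C01_ext_Lnorm f) (ltry _).
Qed.

Definition L2_of_C01 (f : C01 R) : L2_01 := Lclass (Lfun_Sub (lee1n 2) (C01_ext_Lfun f)).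

Lemma L2_of_C01B (f g : C01 R) : L2_of_C01 (f - g) = L2_of_C01 f - L2_of_C01 g.
Proof.
apply/eqP; rewrite eq_sym subr_eq; apply/eqP.
rewrite /L2_of_C01 -LclassD; congr Lclass; apply/LfuneqP => x.
exact: esym (subrK (g (clamp01 x)) (f (clamp01 x))).
Qed.

Lemma L2_of_C01_norm (f : C01 R) : `|L2_of_C01 f| <= `|f|.
Proof.
rewrite [leLHS]Lspace_normE -lee_fin finite_norm_fine.
exact: C01_ext_Lnorm.
Qed.

Lemma nonexpansive_continuous (E F : normedModType R) (h : E -> F) :
  (forall x y, `|h x - h y| <= `|x - y|) -> continuous h.
Proof.
move=> hle x; apply/cvgrPdist_lt => e e0.
have /cvgrPdist_lt/(_ e e0) : y @[y --> x] --> x by exact: cvg_id.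
by apply: filterS => y; exact: le_lt_trans.
Qed.

Lemma L2_of_C01_continuous : continuous L2_of_C01.
Proof.
apply: nonexpansive_continuous => f g.
by rewrite -L2_of_C01B L2_of_C01_norm.
Qed.

End L2_01.

Section processes.
Context {R : realType} d (T : measurableType d) (P : probability T R).
Context (X : I01 R -> {RV P >-> R}) (cX : sample_continuous X).

HB.instance Definition _ :=
  isMeasurableFun.Build _ _ T (borel (C01 R)) (path01 cX) (path01_measurable cX).

Definition path_C01 : {RV P >-> borel (C01 R)} := path01 cX.

Definition path_L2_fun (w : T) : borel (L2_01 R) := L2_of_C01 (path01 cX w).

Lemma path_L2_measurable : measurable_fun setT path_L2_fun.
Proof.
apply: (@measurableT_comp _ _ _ _ _ _ (@L2_of_C01 R : borel (C01 R) -> borel (L2_01 R))).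
  by apply: continuous_borel; exact: L2_of_C01_continuous.
exact: path01_measurable.
Qed.

HB.instance Definition _ :=
  isMeasurableFun.Build _ _ T (borel (L2_01 R)) path_L2_fun path_L2_measurable.

Definition path_L2 : {RV P >-> borel (L2_01 R)} := path_L2_fun.
End processes.

(* Main.v *)
(* On [0, 1] with Lebesgue measure let Z(u) = 1/u, a Pareto variable of index 1,
   and X_t = Z (1 + max(0, 1 - Z t)).  The spike at t = 0 has relative height 1
   but width 1/Z, so it vanishes in L^2 as Z grows: u X(u) tends to the constant
   function 1 in L^2 as u -> 0+.  After the substitution v = n u,
   n P(X/n \in .) is the image of the Lebesgue measure on ]0, n] under
   v |-> X(v/n)/n, and by dominated convergence it tends to the image of the
   Lebesgue measure on ]0, +oo[ under v |-> 1/v.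
   In C[0, 1] the sup-norm of X always equals X_0, and equals 2 X_t as soon as
   Z >= 1/t.  Hence any limit measure is carried by the functions f such that
   |f| = f(0) and |f| = 2 f(1/k) for all k >= 1; letting k tend to infinity,
   continuity leaves only f = 0. *)
Require Import Defs.
From HB Require Import structures.
From mathcomp Require Import all_boot all_order all_algebra.
From mathcomp Require Import all_classical all_reals all_analysis.
From mathcomp Require Import measurable_realfun.
From mathcomp Require Import lra.
Set Implicit Arguments. Unset Strict Implicit. Unset Printing Implicit Defensive.
Import Order.TTheory GRing.Theory Num.Theory.
Import numFieldNormedType.Exports.
Local Open Scope classical_set_scope.
Local Open Scope ring_scope.

(** * Scaling of Lebesgue measure and continuity of extended test functions *)

Section borel_lebesgue.
Context {R : realType}.

(** By uniqueness of Lebesgue measure: [t] times its image under multiplication by [t] gives every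
    half-open interval its length. *)
Lemma lebesgue_measure_scale (t : R) (A : set (measurableTypeR R)) :
  0 < t -> measurable A ->
  lebesgue_measure ( *%R t @^-1` A) = (t^-1%:E * lebesgue_measure A)%E.
Proof.
move=> t0 mA.
have mt : measurable_fun setT ( *%R t : measurableTypeR R -> measurableTypeR R).
  exact: mulrl_measurable.
pose t_nng := NngNum (ltW t0).
pose mu : {measure set (measurableTypeR R) -> \bar R} :=
  mscale t_nng (pushforward lebesgue_measure
    ( *%R t : measurableTypeR R -> measurableTypeR R)).
rewrite (@lebesgue_measure_unique R (mu mt) _ A mA).
  by rewrite /mu /= /mscale /= muleA -EFinM mulVf ?gt_eqF// mul1e.
move=> _ [[a b]] _ <-.
rewrite /mu /= /mscale /= /pushforward /=.
rewrite (_ : _ @^-1` _ = `]t^-1 * a, t^-1 * b]%classic); last first.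
  by apply/seteqP; split => x /=; rewrite !in_itv /= ltr_pdivrMl// ler_pdivlMl.
rewrite !lebesgue_measure_itv /= !lte_fin ltr_pM2l ?invr_gt0//.
case: ifPn => _; last by rewrite mule0.
by rewrite -!EFinD -EFinM -mulrBr mulrA divff ?gt_eqF// mul1r.
Qed.

Lemma continuous_borel_real (E : normedModType R) (g : E -> R) :
  continuous g -> measurable_fun setT (g : borel E -> R).
Proof.
move=> /continuousP cg; apply: (measurability _ (RGenOpens.measurableE R)).
move=> _ [_ [a [b ->] <-]]; rewrite setTI; apply: open_borel; apply: cg.
exact: interval_open.
Qed.

(** A test function vanishes near 0 except possibly at 0 itself, so resetting its value there to 0
    removes the only possible discontinuity. *)
Lemma C0_patch_continuous (E : normedModType R) (f : E -> R) :
  C0 E f -> continuous (f \_ (punctured E)).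
Proof.
have oE : open (punctured E).
  rewrite (_ : punctured E = ~` [set (0 : E)]); last by apply/seteqP; split=> x /= /eqP.
  apply: closed_openC; apply: accessible_closed_set1.
  by apply: hausdorff_accessible; exact: norm_hausdorff.
move=> [+ _ f0] x; rewrite continuous_open_subspace// => cf.
have [->|x0] := eqVneq x 0.
  rewrite /continuous_at patchE memNset /=; last by rewrite /punctured /= eqxx.
  apply: cvg_near_cst; move: f0; rewrite near_withinE; apply: filterS => y fy.
  by rewrite patchE; case: ifPn => // /[1!inE] y0; exact: fy.
have Ex : x \in punctured E by rewrite inE.
rewrite /continuous_at patchE Ex.
apply: cvg_trans (cf _ Ex); apply: near_eq_cvg.
have : nbhs x (punctured E) by apply: open_nbhs_nbhs; split.
by apply: filterS => y Ey; rewrite patchE mem_set.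
Qed.

End borel_lebesgue.

(** * The uniform law on [0, 1], with the whole real line as sample space *)

Section uniform01.
Context (R : realType).

Definition uniform01 : set (measurableTypeR R) -> \bar R := lebesgue01 R.

HB.instance Definition _ := Measure.on uniform01.
HB.instance Definition _ :=
  Measure_isProbability.Build _ _ R uniform01 (lebesgue01_setT R).

Lemma uniform01E (A : set (measurableTypeR R)) :
  uniform01 A = lebesgue_measure (A `&` `[0, 1]).
Proof. by []. Qed.

End uniform01.
Arguments uniform01 R : clear implicits.

(** * The candidate limit: the image of Lebesgue measure under v |-> e / v *)

Section hyperbola.
Context {R : realType} (E : normedModType R) (e : E).
Local Notation mu := (@lebesgue_measure R).

(** The default value 0 sends the half-line [v <= 0] to the origin, whose mass [hyperbola_law]
    discards. *)
Definition hyperbola (v : measurableTypeR R) : borel E :=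
  if (0 < v :> R) then (v : R)^-1 *: e else 0.

Lemma hyperbola_measurable : measurable_fun setT hyperbola.
Proof.
apply: measurable_borel => U oU.
(* The map is continuous on ]0, +oo[, while ]-oo, 0] lies in the preimage entirely or not at all. *)
rewrite (_ : _ @^-1` U = (`]0, +oo[ `&` [set v : R | U (v^-1 *: e)]) `|`
    (if 0 \in U then `]-oo, 0] else set0)%classic); last first.
  apply/seteqP; split => v; rewrite /= /hyperbola in_itv /= andbT.
    case: ifPn => v0 Uv; [by left|right].
    by rewrite mem_set //= in_itv /= leNgt.
  move=> [[-> //]|]; case: ifPn => //; rewrite inE => U0.
  by rewrite /= in_itv /= leNgt => /negbTE ->.
apply: measurableU; last by case: ifPn => _ //; exact: measurable_itv.
apply: open_measurable.
have oI : open (`]0, +oo[%classic : set R) by exact: interval_open.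
move: U oU; apply/(continuous_inP _ oI) => v; rewrite inE /= in_itv /= andbT => v0.
apply: cvgZr_tmp.
apply: cvgV; first by rewrite gt_eqF.
exact: cvg_id.
Qed.

Lemma hyperbola_scale (t : R) v : 0 < t ->
  hyperbola (t * v) = t^-1 *: (hyperbola v : E).
Proof.
move=> t0; rewrite /hyperbola pmulr_rgt0//; case: ifPn => _; last by rewrite scaler0.
by rewrite scalerA invfM.
Qed.


Definition hyperbola_pushforward : {measure set (borel E) -> \bar R}.
Proof.
by refine (pushforward mu hyperbola : {measure set _ -> \bar R});
  exact: hyperbola_measurable.
Defined.

Definition hyperbola_law : {measure set (borel E) -> \bar R} :=
  mrestr hyperbola_pushforward (@punctured_borel R E).

Lemma hyperbola_lawE A :
  hyperbola_law A = mu (hyperbola @^-1` (A `&` punctured E)).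
Proof. by []. Qed.

Lemma hyperbola_law0 : hyperbola_law [set (0 : E)] = 0%E.
Proof.
rewrite hyperbola_lawE (_ : _ `&` _ = set0) ?preimage_set0 ?measure0//.
by apply/seteqP; split=> // x [/= ->]; rewrite /punctured /= eqxx.
Qed.

Lemma norm_hyperbola v : `|hyperbola v : E| <= `|e| / `|v : R|.
Proof.
rewrite /hyperbola; case: ifPn => v0; last by rewrite normr0 divr_ge0.
by rewrite normrZ normfV mulrC.
Qed.

(** A set at distance at least r > 0 from the origin can be hit only by parameters v <= |e| / r. *)
Lemma hyperbola_law_finite (A : set (borel E)) : measurable A ->
  bounded_away0 A -> (hyperbola_law A < +oo)%E.
Proof.
move=> mA [r r0 Ar]; rewrite hyperbola_lawE.
have : (mu `[0%R, (`|e| / r)%R] < +oo)%E.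
  by rewrite lebesgue_measure_itv /= ; case: ifPn => _; rewrite ?ltry// -EFinB ltry.
apply: le_lt_trans; apply: le_measure; rewrite ?inE.
- rewrite -[X in measurable X]setTI; apply: hyperbola_measurable => //.
  by apply: measurableI => //; exact: punctured_borel.
- exact: measurable_itv.
move=> v [/Ar + hv]; rewrite /= in_itv /=.
have v0 : 0 < (v : R).
  by move: hv; rewrite /punctured /= /hyperbola; case: ifPn => //; rewrite eqxx.
rewrite (ltW v0) /= => rv; have := le_trans rv (norm_hyperbola v).
by rewrite (gtr0_norm v0) ler_pdivlMr// ler_pdivlMr// mulrC.
Qed.

Definition hyperbola_M0 : M0 E := MkM0 hyperbola_law0 hyperbola_law_finite.

(** Dividing a point of the curve by [t] multiplies its parameter by [t]; hence the preimage of tA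
    is that of A shrunk by the factor [t], which gives the index 1. *)
Lemma hyperbola_M0_homogeneous (t : R) (A : set (borel E)) : 0 < t ->
  measurable A -> A `<=` punctured E ->
  hyperbola_M0 [set t *: (x : E) | x in A] = ((t `^ (- 1))%:E * hyperbola_M0 A)%E.
Proof.
move=> t0 mA A0; rewrite /= !hyperbola_lawE (setIidl A0) powR_inv1 ?ltW//.
rewrite -lebesgue_measure_scale//; last first.
  by rewrite -[X in measurable X]setTI; exact: hyperbola_measurable.
congr (mu _); apply/seteqP; split => v /=; rewrite hyperbola_scale//.
  by move=> [[x Ax <-] _]; rewrite scalerA mulVf ?gt_eqF// scale1r.
move=> Av; split.
  by exists (t^-1 *: (hyperbola v : E)) => //; rewrite scalerA divff ?gt_eqF// scale1r.
have := A0 _ Av; rewrite /punctured /=; apply: contra_neq => ->.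
by rewrite scaler0.
Qed.

End hyperbola.

(** * Integrals of test functions against images of Lebesgue measure *)

Section pushforward_lebesgue.
Context {R : realType} (E : normedModType R).
Local Notation mu := (@lebesgue_measure R).

(** The measures are compared only off the origin: in the applications [phi] sends a whole half-line
    to 0, and the patched [f] ignores it. *)
Lemma integral_pushforward_lebesgue (nu : M0 E) (phi : measurableTypeR R -> borel E)
    (f : borel E -> R) :
  measurable_fun setT phi -> C0 E f ->
  (forall A : set (borel E), measurable A -> A `<=` punctured E ->
    nu A = mu (phi @^-1` A)) ->
  mu.-integrable setT (EFin \o ((f \_ (punctured E)) \o phi)) ->
  (\int[nu]_(x in punctured E) (f x)%:E =
   \int[mu]_v ((f \_ (punctured E)) (phi v))%:E)%E.
Proof.
move=> mphi Cf nuE ifphi.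
pose pnu : {measure set (borel E) -> \bar R} := pushforward mu phi.
rewrite (eq_measure_integral (pnu mphi)) => [|A mA A0]; last exact: nuE.
rewrite integral_mkcond.
rewrite (_ : _ \_ _ = EFin \o (f \_ (punctured E))); last first.
  by apply/funext => x; rewrite /= !patchE; case: ifP.
rewrite integral_pushforward//.
apply/measurable_EFinP; apply: continuous_borel_real.
exact: C0_patch_continuous.
Qed.

(** If [f] vanishes on the punctured ball of radius r, only parameters v <= C / r contribute. The
    constants precede [phi], so one integrable function dominates a whole sequence of curves. *)
Lemma C0_patch_bound (f : E -> R) (C : R) : 0 <= C -> C0 E f ->
  exists M K : R, forall (phi : R -> E),
    (forall v, v <= 0 -> phi v = 0) -> (forall v, 0 < v -> `|phi v| <= C / v) ->
    forall v, `|(f \_ (punctured E)) (phi v)| <= M * \1_(`[0, K]%classic : set R) v.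
Proof.
move=> C0 [_ [M fM] f0].
have /nbhs_ballP[r /= r0 fr] : nbhs (0 : E) [set x | x != 0 -> f x = 0].
  by move: f0; rewrite near_withinE.
exists `|M|, (C / r) => phi phi0 phiC v.
rewrite patchE; case: ifPn => [|_]; last by rewrite normr0 mulr_ge0.
rewrite inE => pv; have [v0|v0] := leP v 0.
  by move: pv; rewrite /punctured /= phi0// eqxx.
have [fv|/eqP fv] := eqVneq (f (phi v)) 0; first by rewrite fv normr0 mulr_ge0.
rewrite indicE mem_set ?mulr1; first by rewrite (le_trans (fM _ pv))// ler_norm.
rewrite /= in_itv /= (ltW v0) /= leNgt; apply/negP => vr; apply: fv.
apply: fr => //; rewrite -ball_normE /ball_ /= sub0r normrN.
by rewrite (le_lt_trans (phiC _ v0))// ltr_pdivrMr// mulrC -ltr_pdivrMr.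
Qed.

End pushforward_lebesgue.

(** * A criterion for regular variation of index 1 *)

Section criterion.
Context {R : realType}.
Local Notation mu := (@lebesgue_measure R).

Lemma regularly_varying_fun_norm :
  regularly_varying_fun 1 (fun t : R => (NngNum (normr_ge0 t))%:num).
Proof.
split => [|x x0] /=; first exact: normr_measurable.
rewrite powRr1 ?ltW//; apply: cvg_near_cst; near=> t.
have t0 : 0 < t by near: t; exact: nbhs_pinfty_gt.
by rewrite normrM (gtr0_norm t0) (gtr0_norm x0) mulrC mulKf// gt_eqF.
Unshelve. all: by end_near. Qed.

Context (E : normedModType R).
Variable X : {RV (uniform01 R) >-> borel E}.
Variables (e : E) (C : R).
Hypothesis e0 : e != 0.
Hypothesis X0 : forall u : R, ~~ (0 < u <= 1) -> X u = 0.
Hypothesis XC : forall u : R, 0 < u -> `|X u : E| <= C / u.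
Hypothesis Xe : u *: (X u : E) @[u --> (0 : R)^'+] --> e.

(** This is X(v / n) / n, from the substitution v = n u; for [n = 0] the inverse is 0 and so is the
    value. *)
Let Y (n : nat) (v : measurableTypeR R) : borel E :=
  scaled_rv X n%:R^-1 ((n%:R^-1 : R) * v).

Let Y_measurable n : measurable_fun setT (Y n).
Proof.
apply: (@measurableT_comp _ _ _ _ _ _ (scaled_rv X n%:R^-1)).
  exact: scaled_rv_measurable.
exact: mulrl_measurable.
Qed.

Let Y0 n (v : R) : v <= 0 -> Y n v = 0.
Proof.
move=> v0; rewrite /Y /scaled_rv X0 ?scaler0//.
by rewrite negb_and -leNgt mulr_ge0_le0.
Qed.

Let C_ge0 : 0 <= C.
Proof. by have := XC ltr01; rewrite divr1; apply: le_trans. Qed.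

(** The two factors of n cancel, which makes the bound uniform in [n]. *)
Let YC n (v : R) : 0 < v -> `|Y n v : E| <= C / v.
Proof.
move=> v0; rewrite /Y /scaled_rv; case: n => [|n].
  by rewrite invr0 scale0r normr0 divr_ge0// ltW.
rewrite normrZ ger0_norm// ler_pdivrMl//.
by rewrite (le_trans (XC _)) ?mulr_gt0// invfM invrK mulrCA.
Qed.

Let scaled_law_lebesgue n (A : set (borel E)) : (0 < n)%N -> measurable A ->
  A `<=` punctured E ->
  scaled_law X (NngNum (normr_ge0 (n%:R : R))) n A = mu (Y n @^-1` A).
Proof.
move=> n0 mA A0; rewrite [LHS]scaled_law_measureE (setIidl A0) /= uniform01E.
(* Since [X] vanishes off ]0, 1], the preimage of a set avoiding 0 already lies in [0, 1]. *)
rewrite normr_nat (setIidl _); last first.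
  move=> u /A0; rewrite /punctured /= /scaled_rv => u0.
  have : 0 < u <= 1; last by rewrite in_itv /= => /andP[/ltW -> ->].
  by apply: contraNT u0 => /X0 ->; rewrite scaler0.
have -> : Y n @^-1` A = *%R (n%:R^-1) @^-1` (scaled_rv X n%:R^-1 @^-1` A) by [].
(* The Jacobian n of the substitution is exactly the normalization b(n). *)
rewrite lebesgue_measure_scale ?invrK// ?invr_gt0 ?ltr0n//.
by rewrite -[X in measurable X]setTI; exact: scaled_rv_measurable.
Qed.

Let Y_cvg (v : R) : (Y n v : E) @[n --> \oo] --> (hyperbola e v : E).
Proof.
have [v0|v0] := leP v 0.
  rewrite /hyperbola ltNge v0 /=.
  by under eq_fun do rewrite Y0//; exact: cvg_cst.
rewrite /hyperbola v0.
have nv : (n%:R^-1 * v : R) @[n --> \oo] --> (0 : R).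
  rewrite -[0 in X in _ --> X](mul0r v); apply: cvgMl.
  apply/(gtr0_cvgV0 (f := fun n : nat => n%:R : R)); last exact: cvgr_idn.
  by near=> n; rewrite ltr0n; near: n; exact: nbhs_infty_gt.
have {}nv : (n%:R^-1 * v : R) @[n --> \oo] --> (0 : R)^'+.
  move=> A Ar; have : \forall n \near \oo, 0 < n%:R^-1 * v :> R -> A (n%:R^-1 * v).
    exact: (nv [set t : R | 0 < t -> A t] Ar).
  apply: filterS2 (nbhs_infty_gt 0%N) => n n0; apply.
  by rewrite mulr_gt0// invr_gt0 ltr0n.
(* X(v / n) / n is v^-1 times u X(u) at u = v / n, and this u tends to 0 from the right. *)
have : v^-1 *: ((n%:R^-1 * v) *: (X (n%:R^-1 * v) : E)) @[n --> \oo] --> v^-1 *: e.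
  apply: cvgZl_tmp.
  exact: (cvg_comp _ _ nv Xe).
apply: cvg_trans; apply: near_eq_cvg; near=> n.
by rewrite /Y /scaled_rv scalerA mulrCA mulVf ?gt_eqF// mulr1.
Unshelve. all: by end_near. Qed.

(** With b(t) = |t|, both sides become Lebesgue integrals over the line, and dominated convergence
    along [Y n] applies. *)
Lemma regularly_varying_index_hyperbola : regularly_varying_index 1 X.
Proof.
exists (hyperbola_M0 e), 1, (fun t => NngNum (normr_ge0 t)); split.
- rewrite /= hyperbola_lawE setTI.
  have /gt_eqF -> // : (0 < mu (hyperbola e @^-1` punctured E))%E.
  apply: (@lt_le_trans _ _ (mu `]0%R, 1%R])).
    by rewrite lebesgue_measure_itv /= lte_fin ltr01 -EFinB subr0 lte_fin.
  apply: le_measure; rewrite ?inE; first exact: measurable_itv.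
    rewrite -[X in measurable X]setTI; apply: hyperbola_measurable => //.
    exact: punctured_borel.
  move=> v /=; rewrite in_itv /= => /andP[v0 _].
  by rewrite /punctured /= /hyperbola v0 scaler_eq0 invr_eq0 (negbTE e0) gt_eqF.
- exact: regularly_varying_fun_norm.
(* The constant C + |e| bounds both the curves [Y n] and their limit, so a single dominating
   function serves for all. *)
- move=> f Cf; have [M [K MK]] := C0_patch_bound (addr_ge0 C_ge0 (normr_ge0 e)) Cf.
  set g := f \_ (punctured E).
  have cg : continuous g by exact: C0_patch_continuous.
  have mg : measurable_fun setT (g : borel E -> R) by exact: continuous_borel_real.
  pose G := fun v : R => (M * \1_(`[0, K]%classic : set R) v)%:E.
  have iG : mu.-integrable setT G.
    rewrite /G; under eq_fun do rewrite EFinM.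
    exact/integrableZl/integrable_indic_itv.
  have gY n v : `|g (Y n v)| <= M * \1_(`[0, K]%classic : set R) v.
    apply: MK => {}v; first exact: Y0.
    by move=> v0; rewrite (le_trans (YC n v0))// ler_pM2r ?invr_gt0// lerDl.
  have gh v : `|g (hyperbola e v)| <= M * \1_(`[0, K]%classic : set R) v.
    apply: MK => {}v; first by rewrite /hyperbola leNgt => /negbTE ->.
    move=> v0; rewrite (le_trans (norm_hyperbola _ _))//.
    by rewrite gtr0_norm// ler_pM2r ?invr_gt0// lerDr.
  have igY n : mu.-integrable setT (EFin \o (g \o Y n)).
    apply: (le_integrable _ _ _ iG) => //.
      by apply/measurable_EFinP; exact: measurableT_comp.
    by move=> v _; rewrite /G /= lee_fin (le_trans (gY n v))// ler_norm.
  have igh : mu.-integrable setT (EFin \o (g \o hyperbola e)).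
    apply: (le_integrable _ _ _ iG) => //.
      apply/measurable_EFinP; apply: measurableT_comp => //.
      exact: hyperbola_measurable.
    by move=> v _; rewrite /G /= lee_fin (le_trans (gh v))// ler_norm.
  rewrite (integral_pushforward_lebesgue (hyperbola_measurable e) Cf _ igh); last first.
    by move=> A mA A0; rewrite /= hyperbola_lawE (setIidl A0).
  have : (\int[mu]_v (g (Y n v))%:E @[n --> \oo] -->
      \int[mu]_v (g (hyperbola e v))%:E)%E.
    apply: (dominated_cvg _ _ _ _ iG) => //.
    + by move=> n; have /integrableP[] := igY n.
    + move=> v _; apply: cvg_EFin; first exact: nearW.
      exact: (cvg_comp _ _ (@Y_cvg v) (cg _)).
    + by move=> n v _; rewrite /G lee_fin gY.
  apply: cvg_trans; apply: near_eq_cvg; near=> n.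
  have n0 : (0 < n)%N by near: n; exact: nbhs_infty_gt.
  rewrite (integral_pushforward_lebesgue (@Y_measurable n) Cf _ (igY n))//.
  by move=> A mA A0; exact: scaled_law_lebesgue.
- by move=> t A; exact: hyperbola_M0_homogeneous.
Unshelve. all: by end_near. Qed.

End criterion.

(** * Null sets of a limit measure *)

Section limit_law.
Context {R : realType} d (T : measurableType d) (P : probability T R).
Context (E : normedModType R).

(** [G] need not be a test function, but its truncations [F r] are. Their integrals against the
    scaled laws are eventually 0, hence so are their integrals against the limit. *)
Lemma limit_law_negligible (X : {RV P >-> borel E}) (b : R -> {nonneg R})
    (mu : M0 E) (G : E -> R) :
  cvg_M0 (fun n => scaled_law X (b n%:R) n) mu -> continuous G ->
  (forall r : R, 0 < r -> \forall n \near \oo, forall w,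
     r < `|n%:R^-1 *: (X w : E)| -> G (n%:R^-1 *: (X w : E)) = 0) ->
  mu.-negligible [set x : borel E | (x : E) != 0 /\ G x != 0].
Proof.
move=> Xmu cG GX.
(* Continuous, with values in [0, 1], and zero exactly where G vanishes or |x| <= r. *)
pose F r (x : E) := Num.min 1 `|G x| * Num.min 1 (Num.max 0 (`|x| - r)).
have cF r : continuous (F r).
  move=> x; apply: cvgM; apply: (@continuous_min R E (cst 1)) => //; try exact: cvg_cst.
    by apply: cvg_norm; exact: cG.
  apply: (@continuous_max R E (cst 0)); first exact: cvg_cst.
  by apply: cvgB; [apply: cvg_norm; exact: cvg_id|exact: cvg_cst].
have F_ge0 r x : 0 <= F r x by rewrite mulr_ge0// le_min ler01 ?normr_ge0// le_max lexx.
have F_eq0 r x : (F r x == 0) = (G x == 0) || (`|x| <= r).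
  have min1_eq0 (y : R) : 0 <= y -> (Num.min 1 y == 0) = (y == 0).
    by move=> y0; rewrite minEle; case: ifPn => // y1;
      rewrite oner_eq0 gt_eqF// (lt_le_trans ltr01).
  rewrite mulf_eq0 !min1_eq0 ?normr_ge0 ?le_max ?lexx// normr_eq0.
  by congr (_ || _); rewrite eq_le le_max lexx andbT ge_max lexx subr_le0.
have mF r : measurable_fun setT (F r : borel E -> R) by exact: continuous_borel_real.
have CF r : 0 < r -> C0 E (F r).
  move=> r0; split.
  - exact: continuous_subspaceT.
  - exists 1 => x _; rewrite ger0_norm// mulr_ile1 ?ge_min ?lexx// le_min ler01 ?normr_ge0//.
    by rewrite le_max lexx.
  - rewrite near_withinE; near=> x => _; apply/eqP; rewrite F_eq0; apply/orP; right.
    by near: x; exact: nbhs0_le.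
have ae0 (nu : M0 E) r : (\int[nu]_(x in punctured E) (F r x)%:E = 0)%E <->
    nu.-negligible [set x : borel E | (x : E) != 0 /\ F r x != 0].
  have -> : (\int[nu]_(x in punctured E) (F r x)%:E =
      \int[nu]_(x in punctured E) `|(F r x)%:E|)%E.
    by apply: eq_integral => x _; rewrite gee0_abs// lee_fin.
  rewrite ae_eq_integral_abs; [|exact: punctured_borel|]; last first.
    by apply/measurable_EFinP; exact: measurable_funTS.
  split; apply: negligibleS => x /=.
    by move=> [x0 Fx0] /(_ x0) [] /eqP; rewrite (negbTE Fx0).
  move=> /not_implyP[x0 Fx0]; split => //.
  by apply: contra_notN Fx0 => /eqP ->.
have muF r : 0 < r -> mu.-negligible [set x : borel E | (x : E) != 0 /\ F r x != 0].
  move=> r0; apply/ae0.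
  apply: cvg_unique (Xmu _ (CF _ r0)) _ => //.
  apply: cvg_near_cst; apply: filterS (GX _ r0) => n GXn; apply/ae0.
  exists [set x : borel E | F r x != 0]; split; last by move=> x [].
    rewrite -[X in measurable X]setTI.
    rewrite (_ : [set x | _] = F r @^-1` (~` [set 0])); last first.
      by apply/seteqP; split => x /= /eqP.
    by apply: mF => //; apply: measurableC.
  rewrite scaled_law_measureE (_ : _ @^-1` _ = set0) ?measure0 ?mule0//.
  apply/seteqP; split => // w [/= + _]; rewrite F_eq0 negb_or -ltNge => /andP[GX0 rX].
  by rewrite GXn ?eqxx in GX0.
(* The radii 1 / (k + 1) exhaust the complement of the origin. *)
apply: negligibleS (negligible_bigcup (fun k => muF k.+1%:R^-1 _)); last by [].
move=> x [x0 Gx0]; have [k _ /(_ k (leqnn k)) /= ke] :=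
  near_infty_natSinv_lt (PosNum (etrans (normr_gt0 (x : E)) x0)).
exists k => //; split => //; rewrite F_eq0 negb_or Gx0 /= -ltNge//.
Unshelve. all: by end_near. Qed.
End limit_law.

(** * L^2 norms of continuous functions *)

Section L2_bounds.
Context {R : realType}.

Lemma L2_of_C01Z (a : R) (f : C01 R) : L2_of_C01 (a *: f) = a *: L2_of_C01 f.
Proof. by rewrite /L2_of_C01 -LclassZ; congr Lclass; apply/LfuneqP => x. Qed.

Lemma L2_of_C01_eq0 (f : C01 R) : L2_of_C01 f = 0 ->
  ae_eq (lebesgue01 R) setT (C01_ext f) (cst 0).
Proof. by move=> /LclassP. Qed.

Definition C01_one : C01 R := C01_mk (@C01_cst_continuous R 1).

Lemma L2_one_neq0 : L2_of_C01 C01_one != 0.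
Proof.
apply/eqP => /L2_of_C01_eq0 [N [mN N0 sN]].
have : (lebesgue01 R setT <= lebesgue01 R N)%E.
  apply: le_measure; rewrite ?inE// => x _; apply: sN => /= /(_ I) /eqP.
  by rewrite oner_eq0.
by rewrite lebesgue01_setT N0 lee_fin ler10.
Qed.

(** The square of f is at most the indicator of [0, r], so its integral is at most r. *)
Lemma L2_of_C01_norm_support (f : C01 R) (r : R) : 0 < r < 1 ->
  (forall t, `|f t| <= 1) -> (forall t : I01 R, r < val t -> f t = 0) ->
  `|L2_of_C01 f| <= r `^ 2^-1.
Proof.
move=> /andP[r0 r1] f1 f0.
rewrite [leLHS]Lspace_normE -lee_fin finite_norm_fine.
have i2 : (\int[lebesgue01 R]_x (`|(C01_ext f x)%:E| `^ 2) <= r%:E)%E.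
  (* The domination must hold on the whole line, and [C01_ext] takes the value f(0) left of 0; that
     part has no mass. *)
  pose I := (`]-oo, r]%classic : set (measurableTypeR R)).
  have mI : measurable I by exact: measurable_itv.
  apply: (@le_trans _ _ (\int[lebesgue01 R]_x (\1_I x)%:E)%E).
    apply: ge0_le_integral => //.
    - by move=> x _; exact: poweR_ge0.
    - apply/measurable_EFinP.
      apply: (@measurableT_comp _ _ _ _ _ _ (@powR R ^~ 2)) => //.
      apply: measurableT_comp => //; exact: C01_ext_measurable.
    - by apply/measurable_EFinP; exact: measurable_indic.
    - move=> x _; rewrite poweR_EFin lee_fin indicE; have [xr|xr] := leP x r.
        rewrite mem_set ?in_itv//= (_ : true%:R = 1 `^ 2); last by rewrite powR1.
        by rewrite ge0_ler_powR ?nnegrE//; exact: f1.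
      rewrite /C01_ext /= f0 ?normr0 ?powR0//.
      (* Beyond 1 the clamped point is 1, which still exceeds r because r < 1. *)
      by rewrite lt_max lt_min r1 xr orbT.
  rewrite integral_indic// setIT /lebesgue01 /= /mrestr.
  have : (lebesgue_measure (`[0%R, r] : set (measurableTypeR R)) = r%:E)%E.
    by rewrite lebesgue_measure_itv /= lte_fin r0 -EFinB subr0.
  move=> <-; apply: le_measure; rewrite ?inE; [|exact: measurable_itv|].
    by apply: measurableI => //; exact: measurable_itv.
  by move=> x [/= + ]; rewrite /I /= !in_itv /= => -> /andP[-> _].
rewrite unlock /Lnorm.
rewrite -[(r `^ _)%:E]poweR_EFin.
apply: gt0_ler_poweR => //; rewrite in_itv /= leey andbT.
- by rewrite integral_ge0// => x _; exact: poweR_ge0.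
- by rewrite lee_fin ltW.
Qed.
End L2_bounds.

(** * The spiked Pareto process in both spaces *)

Section process.
Context {R : realType}.

(* Being 0 off ]0, 1] makes the laws of the X / n on E \ {0} images of the
   whole Lebesgue measure. *)
Definition pareto (u : measurableTypeR R) : R :=
  if 0 < (u : R) <= 1 then (u : R)^-1 else 0.

Lemma pareto_measurable : measurable_fun setT pareto.
Proof.
rewrite (_ : pareto = \1_(`]0, 1]%classic : set R) \* (@powR R ^~ (-1))); last first.
  apply/funext => u; rewrite /pareto /= indicE; case: ifPn => u01.
    by rewrite mem_set ?in_itv// mul1r powR_inv1// ltW//; case/andP: u01.
  by rewrite memNset ?mul0r//= in_itv /=; exact/negP.
apply: measurable_funM; first exact: measurable_indic.
exact: measurable_powR.
Qed.

Lemma pareto_ge0 u : 0 <= pareto u.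
Proof.
by rewrite /pareto; case: ifPn => // /andP[u0 _]; rewrite invr_ge0 ltW.
Qed.

(** For z > 0 the bump over the constant 1 has height 1 and ends at t = 1 / z; for z = 0 the value
    is 2 throughout, which the factor [pareto u = 0] cancels in [spiked_path]. *)
Definition spike (z t : R) : R := 1 + Num.max 0 (1 - z * t).

Lemma spike_continuous (z : R) : continuous (fun t : I01 R => spike z (val t)).
Proof.
have spikez : continuous (spike z).
  move=> t; apply: cvgD; first exact: cvg_cst.
  apply: (@continuous_max R R (cst 0) (fun t => 1 - z * t)); first exact: cvg_cst.
  by apply: cvgB; [exact: cvg_cst|apply: cvgM; [exact: cvg_cst|exact: cvg_id]].
move=> t; apply: (@continuous_comp _ _ _ (val : I01 R -> R) (spike z)).
  exact: initial_continuous.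
exact: spikez.
Qed.

Definition spike01 z : C01 R := C01_mk (@spike_continuous z).

Definition spiked_path (t : I01 R) (u : measurableTypeR R) : R :=
  pareto u * spike (pareto u) (val t).

Lemma spiked_path_measurable t : measurable_fun setT (spiked_path t).
Proof.
have mp := pareto_measurable.
apply: measurable_funM => //; apply: measurable_funD => //.
apply: measurable_maxr => //; apply: measurable_funB => //.
exact: measurable_funM.
Qed.

HB.instance Definition _ t :=
  isMeasurableFun.Build _ _ _ _ (spiked_path t) (spiked_path_measurable t).

Definition spiked_process (t : I01 R) : {RV (uniform01 R) >-> R} := spiked_path t.

Lemma spiked_process_continuous : sample_continuous spiked_process.
Proof. by move=> u; exact: C01_scale_continuous (spike01 (pareto u)). Qed.

Local Notation cX := spiked_process_continuous.

Lemma spiked_pathE u : path01 cX u = pareto u *: spike01 (pareto u).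
Proof. by apply/C01P. Qed.

Lemma spike_bounds (z t : R) : 0 <= z -> 0 <= t -> 1 <= spike z t <= 2.
Proof.
move=> z0 t0; have := mulr_ge0 z0 t0; rewrite /spike => zt.
by rewrite lerDl le_max lexx /= -[leRHS]/(1 + 1) lerD2l ge_max ler01 gerBl.
Qed.

Lemma I01_ge0 (t : I01 R) : 0 <= val t.
Proof. by have := valP t; rewrite inE /I01 /= in_itv /= => /andP[]. Qed.

Lemma val_clamp01 (x : R) : 0 <= x <= 1 -> val (clamp01 x) = x.
Proof. by move=> /andP[x0 x1]; rewrite /= min_r// max_r. Qed.

Lemma spiked_path0 u : path01 cX u (clamp01 0) = 2 * pareto u.
Proof.
rewrite spiked_pathE C01Z mulrC; congr (_ * _).
rewrite -[LHS]/(spike (pareto u) (val (clamp01 0))) val_clamp01 ?lexx ?ler01//.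
by rewrite /spike mulr0 subr0 max_r.
Qed.

Lemma norm_spiked_path u : `|path01 cX u : C01 R| = 2 * pareto u.
Proof.
have p0 := pareto_ge0 u.
apply/eqP; rewrite eq_le; apply/andP; split.
  apply: C01_norm_le => t; rewrite spiked_pathE C01Z /=.
  have /andP[s1 s2] := spike_bounds p0 (I01_ge0 t).
  by rewrite normrM !ger0_norm// ?(le_trans ler01 s1)// mulrC ler_wpM2r.
rewrite -spiked_path0 (le_trans (ler_norm _))//; exact: C01_norm_ub.
Qed.

(** The criterion is applied with the constant function 1 as e; C = 2 comes from the sup-norm, which
    dominates the L^2 norm. *)
Lemma path_L2_regularly_varying : regularly_varying (path_L2 cX).
Proof.
exists 1; first exact: ltr01.
have p_out (u : R) : ~~ (0 < u <= 1) -> pareto u = 0 by rewrite /pareto => /negbTE ->.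
apply: (@regularly_varying_index_hyperbola R (L2_01 R) (path_L2 cX)
  (L2_of_C01 C01_one) 2).
- exact: L2_one_neq0.
- by move=> u u0; rewrite /path_L2 /= /path_L2_fun spiked_pathE p_out//;
    rewrite L2_of_C01Z scale0r.
- move=> u u0; rewrite (le_trans (L2_of_C01_norm _))//.
  rewrite norm_spiked_path ler_pM2l// /pareto; case: ifPn => // _.
  by rewrite invr_ge0 ltW.
(* Here Z = 1 / u, so u X(u) - 1 is the bare spike; it is supported in [0, u] and its L^2 norm is at
   most the square root of u. *)
- have sE (u : R) : 0 < u < 1 -> u *: L2_of_C01 (path01 cX u) - L2_of_C01 C01_one =
      L2_of_C01 (spike01 u^-1 - C01_one).
    move=> /andP[u0 u1]; rewrite L2_of_C01B spiked_pathE L2_of_C01Z /pareto u0 (ltW u1) /=.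
    by rewrite scalerA divff ?gt_eqF// scale1r.
  apply/cvgrPdist_lt => r r0.
  have /cvgrPdist_lt/(_ _ r0) := @powR_cvg0 R 2^-1 (ltac:(by [])).
  have : \forall u \near (0 : R)^'+, 0 < u < 1.
    by near=> u; apply/andP; split; near: u; [exact: nbhs_right_gt|exact: nbhs_right_lt].
  apply: filterS2 => u u01; have /andP[u0 u1] := u01; rewrite sub0r normrN => ur.
  rewrite distrC sE// (le_lt_trans _ ur)// ger0_norm ?powR_ge0//.
  apply: L2_of_C01_norm_support => // t.
    rewrite C01D C01N /= /spike addrC addKr.
    by rewrite ger0_norm ?le_max ?lexx// ge_max ler01 gerBl mulr_ge0 ?invr_ge0 ?I01_ge0// ltW.
  move=> ut; rewrite C01D C01N /= /spike addrC addKr max_l//.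
  by rewrite subr_le0 ler_pdivlMl// mulr1 ltW.
Unshelve. all: by end_near. Qed.

Lemma path_C01_not_regularly_varying : ~ regularly_varying (path_C01 cX).
Proof.
move=> [a _ [mu [rho [b [mu0 _ Xmu _]]]]].
have eval_continuous (t : I01 R) : continuous (fun f : C01 R => f t).
  apply: (@nonexpansive_continuous R (C01 R) R^o) => f g.
  by rewrite -C01N -C01D; exact: C01_norm_ub.
have norm_sub_continuous (E : normedModType R) (c : R) (h : E -> R) :
    continuous h -> continuous (fun x => `|x| - c * h x).
  move=> ch x; apply: cvgB; first by apply: cvg_norm; exact: cvg_id.
  by apply: cvgM; [exact: cvg_cst|exact: ch].
(* Every path attains its norm at t = 0, whatever the size of Z. *)
have G0 : mu.-negligible [set f : borel (C01 R) | (f : C01 R) != 0 /\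
    `|f : C01 R| - 1 * (f : C01 R) (clamp01 0) != 0].
  apply: (limit_law_negligible (G := fun f : C01 R => `|f| - 1 * f (clamp01 0)) Xmu).
    exact: norm_sub_continuous.
  move=> r r0; near=> n => u _; rewrite normrZ ger0_norm// C01Z mul1r -mulrBr.
  by rewrite norm_spiked_path [X in _ - X]spiked_path0 subrr mulr0.
have Gk (k : nat) : mu.-negligible [set f : borel (C01 R) | (f : C01 R) != 0 /\
    `|f : C01 R| - 2 * (f : C01 R) (clamp01 k.+1%:R^-1) != 0].
  apply: (limit_law_negligible (G := fun f : C01 R => `|f| - 2 * f (clamp01 k.+1%:R^-1)) Xmu).
    exact: norm_sub_continuous.
  move=> r r0; near=> n => u.
  have n0 : 0 < n%:R :> R by rewrite ltr0n; near: n; exact: nbhs_infty_gt.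
  rewrite normrZ ger0_norm// C01Z norm_spiked_path => rX.
  suff pk : (path01 cX u : C01 R) (clamp01 k.+1%:R^-1) = pareto u.
    by rewrite [X in _ - 2 * (_ * X)]pk mulrCA subrr.
  rewrite spiked_pathE C01Z -[X in _ * X]/(spike (pareto u) (val (clamp01 k.+1%:R^-1))).
  rewrite val_clamp01 ?invr_ge0 ?ler0n ?invf_le1 ?ler1n ?ltr0n// /spike.
  rewrite max_l ?addr0 ?mulr1// subr_le0 ler_pdivlMr// mul1r.
  (* From 2 Z > r n >= 2 (k + 1) follows Z > k + 1, so the point 1 / (k + 1) lies beyond the
     spike. *)
  have : k.+1%:R * 2 / r <= n%:R by near: n; exact: nbhs_infty_ger.
  rewrite ler_pdivrMr//.
  move: rX; rewrite ltr_pdivlMl//; lra.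
have M00 : mu.-negligible [set (0 : borel (C01 R))].
  exists [set 0]; split => //; last exact: M0_at0.
  rewrite -[X in measurable X]setCK; apply: measurableC.
  rewrite (_ : ~` _ = punctured (C01 R)); first exact: punctured_borel.
  by apply/seteqP; split => f /= /eqP.
(* A nonzero f outside all these null sets would satisfy |f| = f(0) and |f| = 2 f(1 / (k + 1)) for
   every k; continuity at 0 then gives |f| = 2 |f|. *)
have : mu.-negligible setT.
  apply: negligibleS (negligibleU (negligibleU G0 (negligible_bigcup Gk)) M00).
  move=> f _; apply: contrapT => /not_orP[/not_orP[fG0 fGk] f0].
  have {}f0 : (f : C01 R) != 0 by apply/eqP => fE; apply: f0.
  have f_at0 : `|f : C01 R| = C01_ext f 0.
    apply/eqP; rewrite -subr_eq0 -[X in _ - X]mul1r; apply/negPn/negP => h.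
    exact: fG0.
  have f_atk k : `|f : C01 R| = 2 * C01_ext f k.+1%:R^-1.
    apply/eqP; rewrite -subr_eq0; apply/negPn/negP => h.
    by apply: fGk; exists k.
  have ek : 2 * C01_ext f k.+1%:R^-1 @[k --> \oo] --> 2 * C01_ext f 0.
    apply: cvgM; first exact: cvg_cst.
    exact: (cvg_comp _ _ cvg_harmonic (C01_ext_continuous (f:=f) (x:=0))).
  have : 2 * C01_ext f 0 = `|f : C01 R|.
    apply: cvg_unique ek _ => //; apply: cvg_near_cst.
    by apply: nearW => k; exact: esym (f_atk k).
  have : 0 < `|f : C01 R| by rewrite normr_gt0.
  rewrite -f_at0; lra.
move=> [N [mN N0 sN]]; move/eqP : mu0; apply; apply/eqP.
by rewrite eq_le measure_ge0 andbT -N0; apply: le_measure; rewrite ?inE.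
Unshelve. all: by end_near. Qed.
End process.

Theorem proposition3p5 (R : realType) :
  exists (d : measure_display) (T : measurableType d) (P : probability T R)
    (X : I01 R -> {RV P >-> R}) (cX : sample_continuous X),
    regularly_varying (path_L2 cX) /\ ~ regularly_varying (path_C01 cX).
Proof.
exists _, (measurableTypeR R), (uniform01 R), spiked_process.
exists spiked_process_continuous; split.
  exact: path_L2_regularly_varying.
exact: path_C01_not_regularly_varying.
Qed.
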